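(* Let $\psi:E_k\to E_k$ be a vector function all of whose first order partial derivatives exist and are continuous, and let $\psi_0(\eta)=\eta$, $\psi_n(\eta)=\psi(\psi_{n-1}(\eta))$ for $n\in\mathbb{N}$. If $\det[J_\eta(\psi)]$ has no roots $\eta\in E_k$, then, for every $n\in\mathbb{N}$, $\det[J_\eta(\psi_n)]$ has no roots $\eta\in E_k$ either.
   Context: $E_k$ ($k\ge1$) denotes $\mathbb{R}^k$; $\mathbb{N}$ is the set of positive integers. $J_\eta(f)$ denotes the Jacobian matrix of $f$ at $\eta$. *)

(* Defs.v *)
From HB Require Import structures.
From mathcomp Require Import all_boot all_order all_algebra.
From mathcomp Require Import all_classical all_reals all_analysis.

Set Implicit Arguments.
Unset Strict Implicit.
Unset Printing Implicit Defensive.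

Import Order.TTheory GRing.Theory Num.Theory.
Import numFieldNormedType.Exports.

Local Open Scope classical_set_scope.
Local Open Scope ring_scope.

Definition coordinate {R : realType} {k : nat}
    (f : 'rV[R]_k -> 'rV[R]_k) (j : 'I_k) : 'rV[R]_k -> R :=
  fun eta => f eta ord0 j.

(* [delta_mx 0 i] is the i-th vector of the standard basis of R^k, so the
   directional derivative along it is the i-th partial derivative. *)
Definition continuous_partials {R : realType} {k : nat}
    (f : 'rV[R]_k -> 'rV[R]_k) : Prop :=
  forall i j : 'I_k,
    (forall eta, derivable (coordinate f j) eta (delta_mx 0 i)) /\
    continuous (fun eta => 'D_(delta_mx 0 i) (coordinate f j) eta).

(* The library's Jacobian ['J f eta] acts on row vectors on the right: its
   (i, j) entry is the i-th partial derivative of the j-th coordinate, i.e.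
   it is the transpose of the textbook matrix and has the same determinant. *)
Lemma jacobianE {R : realType} {k : nat} (f : 'rV[R]_k -> 'rV[R]_k)
    (eta : 'rV[R]_k) (i j : 'I_k) :
  differentiable f eta ->
  'J f eta i j = 'D_(delta_mx 0 i) (coordinate f j) eta.
Proof.
move=> df.
have dc : derivable f eta (delta_mx 0 i) by exact: diff_derivable.
have -> : 'J f eta i j = ('D_(delta_mx 0 i) f eta) ord0 j.
  by rewrite deriveEjacobian// -rowE [RHS]mxE.
by rewrite derive_mx// mxE.
Qed.

(* Main.v *)
Require Import Defs.
From HB Require Import structures.
From mathcomp Require Import all_boot all_order all_algebra.
From mathcomp Require Import all_classical all_reals all_analysis.

Set Implicit Arguments.
Unset Strict Implicit.
Unset Printing Implicit Defensive.

Import Order.TTheory GRing.Theory Num.Theory.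
Import numFieldNormedType.Exports.

Local Open Scope classical_set_scope.
Local Open Scope ring_scope.

(** A map whose first partial derivatives exist and are continuous is
    differentiable, so the chain rule applies to its iterates: the Jacobian
    matrix of the (n+1)-st iterate at [eta] is the product of the Jacobian
    matrix of the n-th iterate at [eta] and that of [psi] at the n-th iterate
    of [eta].  Determinants being multiplicative, the Jacobian determinant of
    the n-th iterate at [eta] is the product of the Jacobian determinants of
    [psi] at the first n points of the orbit of [eta], and none of these
    factors vanishes.

    Differentiability ([continuous_partials_differentiable]) is obtained one
    coordinate function at a time.  An increment [h] is decomposed into the
    path that switches its coordinates on one after the other; along each edge
    of this path, which is parallel to a basis vector, the mean value theorem
    turns the increment of the function into a partial derivative at a point
    of the edge, and continuity compares it with the partial derivative at the
    base point ([line_increment_near]). *)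

(** * From continuous partial derivatives to differentiability *)

Lemma is_derive_line (R : realType) (V : normedModType R) (g : V -> R)
    (u v : V) (t : R) :
  derivable g (u + t *: v) v ->
  is_derive t 1 (fun s : R => g (u + s *: v)) ('D_v g (u + t *: v)).
Proof.
move=> /derivableP[dg Dg].
have E : (fun h : R => h^-1 *: (((fun s : R => g (u + s *: v)) \o shift t) (h *: 1)
              - g (u + t *: v)))
       = (fun h : R => h^-1 *: ((g \o shift (u + t *: v)) (h *: v)
              - g (u + t *: v))).
  apply/funext => h /=; congr (_ *: (g _ - _)).
  by rewrite [h *: 1]mulr1 scalerDl addrCA.
by split; [rewrite /derivable E | rewrite /derive E].
Qed.

(** The mean value theorem is applied to [s |-> g (u + (t * s) *: v)] on the
    unit interval, which makes the sign of [t] irrelevant. *)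
Lemma mean_value_line (R : realType) (V : normedModType R) (g : V -> R)
    (u v : V) (t : R) :
  (forall y, derivable g y v) ->
  exists2 c : R, c \in `[0, 1]%R &
    g (u + t *: v) - g u = t * 'D_v g (u + (t * c) *: v).
Proof.
move=> dg.
pose phi := (fun s : R => g (u + s *: v)) \o ( *%R t).
have dphi (s : R) : is_derive s 1 phi ('D_v g (u + (t * s) *: v) * t).
  apply: is_derive1_comp; first exact: is_derive_line.
  by apply: is_derive_eq; rewrite [t *: 1]mulr1.
have [|c c01 Dc] := @MVT_segment R phi _ 0 1 ler01 (fun s _ => dphi s).
  by apply: derivable_within_continuous => s _; apply: ex_derive.
exists c => //; move: Dc.
by rewrite /phi /= mulr1 mulr0 scale0r addr0 subr0 mulr1 mulrC.
Qed.

(** The estimate is uniform in the starting point [u] near [x]: the edges of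
    the path followed below start at points that vary with the increment. *)
Lemma line_increment_near (R : realType) (V : normedModType R) (g : V -> R)
    (x v : V) (e : R) :
  (forall y, derivable g y v) -> {for x, continuous (fun y => 'D_v g y)} ->
  0 < e ->
  \forall u \near x & t \near (0 : R),
    `|g (u + t *: v) - g u - t * 'D_v g x| <= e * `|t|.
Proof.
move=> dg /cvgrPdist_le/(_ e) + e0 => /(_ e0)/nbhs_ballP[d /= d0 dP].
have d20 : 0 < d / 2 by rewrite divr_gt0.
(* the bound on [t] is [d / 2 / (`|v| + 1)], which is positive even for v = 0 *)
have v0 : 0 < `|v| + 1 by rewrite ltr_wpDl.
near=> u t.
have [c + ->] := mean_value_line u t dg.
rewrite in_itv /= => /andP[c0 c1].
rewrite -mulrBr normrM mulrC ler_wpM2r// distrC.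
apply: dP; rewrite -ball_normE /ball_/= opprD addrA.
apply: le_lt_trans (ler_normB _ _) _.
rewrite (splitr d) ltrD//.
rewrite normrZ normrM (ger0_norm c0).
apply: (@le_lt_trans _ _ (`|t| * (`|v| + 1))).
  by rewrite ler_pM// ?mulr_ge0// ?ler_piMr// lerDl.
rewrite -ltr_pdivlMr//.
by near: t; apply: (@pseudometric_normed_Zmodule.nbhs0_lt R R^o); rewrite divr_gt0.
Unshelve. all: by end_near. Qed.

Lemma ler_norm_entry (R : realType) (k : nat) (h : 'rV[R]_k) (i : 'I_k) :
  `|h ord0 i| <= `|h|.
Proof.
by rewrite [leRHS]/Num.Def.normr/= mx_normrE; apply: (le_bigmax _ _ (ord0, i)).
Qed.

(** The [m]-th vertex of the path from [0] to [h]. *)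
Definition truncate (R : realType) (k m : nat) (h : 'rV[R]_k) : 'rV[R]_k :=
  \row_j (if (j < m)%N then h ord0 j else 0).

Lemma truncate_ord (R : realType) (k : nat) (i : 'I_k) (h : 'rV[R]_k) :
  truncate i.+1 h = truncate i h + h ord0 i *: delta_mx 0 i.
Proof.
apply/rowP => j; rewrite !mxE eqxx /= ltnS leq_eqVlt -val_eqE /=.
by case: ltngtP => [||/val_inj ->]; rewrite /= ?mulr0 ?mulr1 ?addr0 ?add0r.
Qed.

Lemma cvg_truncate (R : realType) (k m : nat) :
  @truncate R k m h @[h --> (0 : 'rV[R]_k)] --> (0 : 'rV[R]_k).
Proof.
apply/(@cvgrPdist_le _ _ _ _ (nbhs_filter (0 : 'rV[R]_k))) => e e0; near=> h.
rewrite sub0r normrN [leLHS]/Num.Def.normr/= mx_normrE bigmax_le ?ltW//= => -[i j] _.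
rewrite mxE /=; case: ifP => _; last by rewrite normr0 ltW.
apply: le_trans (ler_norm_entry _ _) _.
by near: h; apply: (@nbhs0_le R 'rV[R]_k).
Unshelve. all: by end_near. Qed.

(** With [e / k.+1] granted to each of the [k] edges, the edge estimates add up
    to the bound [e * `|h|]; there are finitely many edges, so that one
    neighbourhood of [0] serves them all. *)
Lemma linear_approximation_near (R : realType) (k : nat) (g : 'rV[R]_k -> R)
    (x : 'rV[R]_k) (e : R) :
  (forall i y, derivable g y (delta_mx 0 i)) ->
  (forall i, {for x, continuous (fun y => 'D_(delta_mx 0 i) g y)}) ->
  0 < e ->
  \forall h \near (0 : 'rV[R]_k),
    `|g (h + x) - g x - \sum_i h ord0 i * 'D_(delta_mx 0 i) g x| <= e * `|h|.
Proof.
move=> dg cg e0.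
have ek0 : 0 < e / k.+1%:R by rewrite divr_gt0.
near=> h.
have -> : g (h + x) - g x = \sum_(i < k)
    (g (x + truncate i h + h ord0 i *: delta_mx 0 i) - g (x + truncate i h)).
  under eq_bigr do rewrite -addrA -truncate_ord.
  rewrite -(big_mkord xpredT
    (fun i => g (x + truncate i.+1 h) - g (x + truncate i h))).
  rewrite telescope_sumr//; congr (g _ - g _).
    by rewrite addrC; congr (_ + _); apply/rowP => j; rewrite mxE ltn_ord.
  by rewrite -[LHS]addr0; congr (_ + _); apply/rowP => j; rewrite !mxE.
rewrite -sumrB; apply: le_trans (ler_norm_sum _ _ _) _.
apply: (@le_trans _ _ (\sum_(i < k) e / k.+1%:R * `|h|)); last first.
  rewrite sumr_const card_ord -mulrnAl ler_wpM2r// -mulrnAr ler_piMr ?(ltW e0)//.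
  by rewrite -[_ *+ k]mulr_natl ler_pdivrMr ?ltr0n// mul1r ler_nat.
apply: ler_sum => i _.
apply: le_trans (ler_wpM2l (ltW ek0) (ler_norm_entry h i)).
move: i; near: h; apply: filter_forall => i.
have near_x0 := line_increment_near (dg i) (cg i) ek0.
have start : x + truncate i h @[h --> (0 : 'rV[R]_k)] --> x.
  rewrite -[X in _ --> X]addr0.
  exact: (cvgD (cvg_cst _) (@cvg_truncate R k i)).
have step : h ord0 i @[h --> (0 : 'rV[R]_k)] --> (0 : R).
  by have := @coord_continuous R 1 k ord0 i 0; rewrite /continuous_at mxE.
exact: (@cvg_pair _ _ _ _ _ _ (nbhs_filter (0 : 'rV[R]_k)) (nbhs_filter x)
  (nbhs_filter (0 : R)) _ _ start step _ near_x0).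
Unshelve. all: by end_near. Qed.

Lemma scalar_continuous_partials_differentiable (R : realType) (k : nat)
    (g : 'rV[R]_k -> R) (x : 'rV[R]_k) :
  (forall i y, derivable g y (delta_mx 0 i)) ->
  (forall i, {for x, continuous (fun y => 'D_(delta_mx 0 i) g y)}) ->
  differentiable g x.
Proof.
move=> dg cg.
pose L (h : 'rV[R]_k) : R := \sum_i h ord0 i * 'D_(delta_mx 0 i) g x.
have L_linear : linear L.
  move=> a u v; rewrite /L scaler_sumr -big_split; apply: eq_bigr => i _ /=.
  by rewrite !mxE mulrDl -scalerAl.
pose dL : {linear 'rV[R]_k -> R} :=
  HB.pack L (GRing.isLinear.Build _ _ _ _ _ L_linear).
have L_continuous : continuous dL.
  move=> h; apply: differentiable_continuous.
  have -> : (dL : _ -> _) =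
      \sum_i (fun v : 'rV[R]_k => v ord0 i *: 'D_(delta_mx 0 i) g x).
    by apply/funext => v; rewrite fct_sumE.
  apply: differentiable_sum => i; apply: differentiableZl.
  exact: differentiable_coord.
have approx : g \o shift x = cst (g x) + dL +o_ (0 : 'rV[R]_k) id.
  apply/eqaddoP => e e0; near=> h => /=.
  rewrite opprD addrA; near: h; exact: linear_approximation_near.
apply/diff_locallyP; rewrite (diff_unique L_continuous approx).
by split.
Unshelve. all: by end_near. Qed.

Lemma continuous_partials_differentiable (R : realType) (k : nat)
    (f : 'rV[R]_k -> 'rV[R]_k) (x : 'rV[R]_k) :
  continuous_partials f -> differentiable f x.
Proof.
move=> cf.
have -> : f = \sum_j (fun y => coordinate f j y *: delta_mx 0 j).
  apply/funext => y; rewrite fct_sumE [LHS]row_sum_delta.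
  by apply: eq_bigr.
apply: differentiable_sum => j; apply: differentiableZl.
apply: scalar_continuous_partials_differentiable => i.
  exact: (cf i j).1.
exact: (cf i j).2.
Qed.

(** * Jacobians of compositions and iterates *)

(** Jacobian matrices act on row vectors on the right, whence the order of the
    two factors. *)
Lemma jacobian_comp (R : realType) (k l m : nat) (f : 'rV[R]_k -> 'rV[R]_l)
    (g : 'rV[R]_l -> 'rV[R]_m) (x : 'rV[R]_k) :
  differentiable f x -> differentiable g (f x) ->
  'J (g \o f) x = 'J f x *m 'J g (f x).
Proof.
move=> df dg; apply/row_matrixP => i.
by rewrite row_mul !rowE /jacobian !mul_rV_lin1 diff_comp.
Qed.

Lemma jacobian_id (R : realType) (k : nat) (x : 'rV[R]_k) : 'J id x = 1%:M.
Proof.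
apply/row_matrixP => i.
by rewrite !rowE /jacobian mul_rV_lin1 diff_val mulmx1.
Qed.

Lemma differentiable_iter (R : realType) (V : normedModType R) (f : V -> V)
    (n : nat) (x : V) :
  (forall y, differentiable f y) -> differentiable (iter n f) x.
Proof.
move=> df; elim: n => [|n IHn]; first exact: ex_diff.
exact: differentiable_comp.
Qed.

Lemma det_jacobian_iter (R : realType) (k n : nat)
    (f : 'rV[R]_k -> 'rV[R]_k) (x : 'rV[R]_k) :
  (forall y, differentiable f y) ->
  \det ('J (iter n f) x) = \prod_(i < n) \det ('J f (iter i f x)).
Proof.
move=> df; elim: n => [|n IHn].
  by rewrite big_ord0 (jacobian_id x) det1.
rewrite big_ord_recr /= -IHn -det_mulmx -jacobian_comp//.
exact: differentiable_iter.
Qed.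

Theorem corollary4p1 (R : realType) (k : nat) (hk : (0 < k)%N)
    (psi : 'rV[R]_k -> 'rV[R]_k) (hpsi : continuous_partials psi)
    (hdet : ~ exists eta : 'rV[R]_k, \det ('J psi eta) = 0) :
  forall n : nat, (0 < n)%N ->
    ~ exists eta : 'rV[R]_k, \det ('J (iter n psi) eta) = 0.
Proof.
move=> n _ [eta].
rewrite det_jacobian_iter; last first.
  by move=> y; apply: continuous_partials_differentiable.
move=> /eqP/prodf_eq0[i _ /eqP det0].
by apply: hdet; exists (iter i psi eta).
Qed.
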